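(* Let $(X,d)$ be a compact metric space and let $f,g\in C(X)$ be such that $f$ is not identically $0$. Then $f\perp_B g$ if and only if there exist $x,y\in M_{|f|}=\{z\in X: |f(z)|=\|f\|\}$ such that $f(x)g(x)\ge 0$ and $f(y)g(y)\le 0$.
   Context: $C(X)$ is the real normed space of all continuous real-valued functions on $X$ with the supremum norm $\|f\|=\sup_{x\in X}|f(x)|$. Birkhoff-James orthogonality: $f\perp_B g$ means $\|f+\lambda g\|\ge\|f\|$ for all $\lambda\in\mathbb{R}$. *)

(* Defs.v *)
From HB Require Import structures.
From mathcomp Require Import all_boot all_order all_algebra.
From mathcomp Require Import all_classical all_reals all_analysis.

Set Implicit Arguments.
Unset Strict Implicit.
Unset Printing Implicit Defensive.

Import Order.TTheory GRing.Theory Num.Theory.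
Import numFieldNormedType.Exports.

Local Open Scope classical_set_scope.
Local Open Scope ring_scope.

(* [sup] is a true least upper bound only on nonempty bounded sets (it is 0
   otherwise); see [sup_norm_ge] and [sup_norm_le] for the case of a continuous
   function on a nonempty compact space. *)
Definition sup_norm (R : realType) (X : Type) (f : X -> R) : R :=
  sup [set `|f x| | x in [set: X]].

Definition birkhoff_james (R : realType) (X : Type) (f g : X -> R) : Prop :=
  forall lambda : R, sup_norm f <= sup_norm (fun x => f x + lambda * g x).

Definition norm_attaining (R : realType) (X : Type) (f : X -> R) : set X :=
  [set z | `|f z| = sup_norm f].

Lemma sup_norm_ge (R : realType) (X : topologicalType) (f : X -> R) (x : X) :
  compact [set: X] -> continuous f -> `|f x| <= sup_norm f.
Proof.
move=> cX cf; apply: ub_le_sup; last by exists x.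
have : compact (f @` [set: X]).
  by apply: continuous_compact => //; apply: continuous_subspaceT.
move=> /compact_bounded[M [_ /(_ (M + 1))]]; rewrite ltrDl ltr01 => /(_ isT) fM.
by exists (M + 1) => _ [y _ <-]; apply: fM; exists y.
Qed.

Lemma sup_norm_le (R : realType) (X : Type) (f : X -> R) (x0 : X) (M : R) :
  (forall x, `|f x| <= M) -> sup_norm f <= M.
Proof.
by move=> fM; apply: ge_sup => [|_ [x _ <-]//]; exists `|f x0|, x0.
Qed.

(* Main.v *)
Require Import Defs.
From HB Require Import structures.
From mathcomp Require Import all_boot all_order all_algebra.
From mathcomp Require Import all_classical all_reals all_analysis.
From mathcomp Require Import lra.
Import Order.TTheory GRing.Theory Num.Theory.
Import numFieldNormedType.Exports.
Local Open Scope classical_set_scope.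
Local Open Scope ring_scope.

(* For the direct implication, suppose that f g < 0 on the norm-attaining set
   of f.  On the compact set {f g >= 0} the maximum of |f| is then smaller
   than ||f||, so |f + lambda g| < ||f|| there for small lambda > 0; on
   {f g < 0} the values f and lambda g have opposite signs, so
   |f + lambda g| < max(|f|, lambda |g|) <= ||f||.  As |f + lambda g| attains
   its maximum, ||f + lambda g|| < ||f||.  The second point is obtained by
   replacing g with -g. *)

Lemma sup_norm_attained (R : realType) (X : topologicalType) (h : X -> R)
  (x0 : X) :
  compact [set: X] -> continuous h -> exists z, `|h z| = sup_norm h.
Proof.
move=> cptX ch.
have [|z _ zmax] := @compact_EVT_max _ _ (fun x => `|h x|) [set: X]
    (ex_intro _ x0 I) cptX.
  by apply: continuous_subspaceT => x; apply: cvg_norm; exact: ch.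
exists z; apply/eqP; rewrite eq_le sup_norm_ge//=.
by apply: (@sup_norm_le _ _ _ x0) => x; apply: zmax; rewrite inE.
Qed.

(** One half of the direct implication. Only [lambda > 0] is assumed, since each sign of [lambda]
    yields one of the two points. *)
Lemma norm_attaining_nonneg_mul (R : realType) (X : topologicalType)
  (f g : X -> R) :
  compact [set: X] -> continuous f -> continuous g -> 0 < sup_norm f ->
  (forall lambda, 0 < lambda ->
    sup_norm f <= sup_norm (fun x => f x + lambda * g x)) ->
  exists2 x, `|f x| = sup_norm f & 0 <= f x * g x.
Proof.
move=> cptX cf cg N_gt0 bj; apply: contrapT => noz.
(* On an empty [X] the supremum would take its default value 0. *)
have [x0 _] : [set: X] !=set0.
  apply/set0P/eqP => X0; move: N_gt0; rewrite /sup_norm X0 image_set0 sup0.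
  by rewrite ltxx.
pose K := [set x | 0 <= f x * g x].
have cptK : compact K.
  apply: (@subclosed_compact _ K [set: X]) => //.
  apply: (@closed_comp _ _ (fun x => f x * g x) [set y | 0 <= y]).
    by move=> x _; apply: cvgM; [exact: cf|exact: cg].
  exact: closed_ge.
have [m [m_ge0 mltN Km]] : exists m, [/\ 0 <= m, m < sup_norm f
    & forall x, K x -> `|f x| <= m].
  have [K0|/eqP/set0P Kn0] := pselect (K = set0).
    by exists 0; split => // x; rewrite K0.
  have [|z zK zmax] := @compact_EVT_max _ _ (fun x => `|f x|) K Kn0 cptK.
    by apply: continuous_subspaceT => x; apply: cvg_norm; exact: cf.
  exists `|f z|; split => // [|x xK]; last by apply: zmax; rewrite inE.
  (* Equality would make [z] a point excluded by [noz]. *)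
  rewrite lt_neqAle sup_norm_ge// andbT; apply/eqP => zN.
  by apply: noz; exists z => //; rewrite inE in zK.
have G_ge0 : 0 <= sup_norm g by exact: le_trans (sup_norm_ge x0 cptX cg).
(* The [+ 1] keeps the denominator positive and makes [m + l * sup_norm g] equal to
   [sup_norm f - l], a strict bound on [K]. *)
pose l := (sup_norm f - m) / (sup_norm g + 1).
have l_gt0 : 0 < l by rewrite divr_gt0 ?subr_gt0// ltr_wpDl.
have lE : l * sup_norm g + l = sup_norm f - m.
  by rewrite -[X in _ + X]mulr1 -mulrDr divfK// gt_eqF// ltr_wpDl.
have [|z zE] := @sup_norm_attained _ _ (fun x => f x + l * g x) x0 cptX.
  move=> x; apply: cvgD; first exact: cf.
  by apply: cvgM; [exact: cvg_cst|exact: cg].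
have := bj l l_gt0; rewrite -zE leNgt => /negP; apply.
have lgz : `|l * g z| <= l * sup_norm g.
  by rewrite normrM gtr0_norm// ler_pM2l// sup_norm_ge.
have [zK|zK] := leP 0 (f z * g z).
  by have := Km _ zK; have := ler_normD (f z) (l * g z); lra.
(* Off [K] the two terms have strictly opposite signs, so the sum lies strictly between them; [f z]
   is at most [sup_norm f] in absolute value, and [l * g z] is strictly below it. *)
have fz := sup_norm_ge z cptX cf.
have : f z * (l * g z) < 0 by rewrite mulrCA pmulr_rlt0.
move: lgz fz; rewrite !ler_norml ltr_norml => /andP[? ?] /andP[? ?].
case: (ltgtP (f z) 0) => [fz0|fz0|->]; last by rewrite mul0r ltxx.
  by rewrite nmulr_rlt0// => ?; apply/andP; split; lra.
by rewrite pmulr_rlt0// => ?; apply/andP; split; lra.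
Qed.

Theorem theorem4p1 (R : realType) (X : metricType R) (f g : X -> R)
  (cptX : compact [set: X])
  (cf : continuous f) (cg : continuous g)
  (f_neq0 : ~ (forall x, f x = 0)) :
  birkhoff_james f g <->
  exists x y : X, [/\ x \in norm_attaining f, y \in norm_attaining f,
    0 <= f x * g x & f y * g y <= 0].
Proof.
split=> [bj|[x [y [+ + fgx fgy]]] l]; last first.
  rewrite !inE /norm_attaining /= => xN yN.
  have ch : continuous (fun x => f x + l * g x).
    move=> t; apply: cvgD; first exact: cf.
    by apply: cvgM; [exact: cvg_cst|exact: cg].
  (* Compare squares: the cross term is nonnegative. The sign of [l] then decides whether [x] or [y]
     is used. *)
  have increase t : 0 <= f t * (l * g t) -> `|f t| <= `|f t + l * g t|.
    by move=> h; rewrite -ler_sqr ?nnegrE// !real_normK ?num_real//; nra.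
  have [l0|l0] := leP 0 l.
    rewrite -xN (le_trans _ (sup_norm_ge x cptX ch))// increase//.
    by rewrite mulrCA mulr_ge0.
  rewrite -yN (le_trans _ (sup_norm_ge y cptX ch))// increase//.
  by rewrite mulrCA mulr_le0// ltW.
have [x0 /eqP fx0] : exists x, f x <> 0 by exact/existsNP.
have N_gt0 : 0 < sup_norm f.
  by rewrite (lt_le_trans _ (sup_norm_ge x0 cptX cf))// normr_gt0.
have [x xN fgx] := norm_attaining_nonneg_mul _ _ _ _ cptX cf cg N_gt0
  (fun l _ => bj l).
have [||y yN] := norm_attaining_nonneg_mul _ _ f (fun x => - g x)
    cptX cf _ N_gt0.
- by move=> t; apply: cvgN; exact: cg.
(* Perturbing by [l] times [- g] is perturbing by [- l] times [g]. *)
- move=> l _; under eq_fun do rewrite mulrN -mulNr; exact: bj.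
by rewrite mulrN oppr_ge0 => fgy; exists x, y; rewrite !inE.
Qed.
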